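(* Let $n\ge 1$ be an integer. In $K_{0,n}$, for all $B\subseteq\{2,3,\dots,n\}$: (1) $O_B^2=-E_B$, $E_B^2=E_B$ and $E_BO_B=O_B$. (2) For all $k\in\{2,3,\dots,n\}$, $$e_kO_B=\begin{cases}E_B,&k\in B,\\-E_B,&k\notin B,\end{cases}\qquad e_kE_B=\begin{cases}-O_B,&k\in B,\\O_B,&k\notin B.\end{cases}$$ Moreover, (3) $\displaystyle\sum_{B\subseteq\{2,3,\dots,n\}}E_B=1.$
   Context: $K_{0,n}$ is the real associative algebra with unity generated by $e_1,\dots,e_n$ subject to $e_i^2=-1$ and $e_ie_j=e_je_i$ for all $i,j\in\{1,\dots,n\}$. For $A=\{i_1<\cdots<i_l\}\subseteq\{1,\dots,n\}$ put $e_A:=e_{i_1}\cdots e_{i_l}$, with $e_{\{\}}:=1$; the elements $e_A$, $A\subseteq\{1,\dots,n\}$, form a basis of $K_{0,n}$ as a real vector space (dimension $2^n$). For $U=\sum_A a_Ae_A$ with $a_A\in\mathbb{R}$, the grade-$k$ projection is $\langle U\rangle_k:=\sum_{|A|=k}a_Ae_A$ (zero if $k>n$). Operations of conjugation: for $l\in\{1,\dots,n\}$, $U\mapsto U^{(l)}$ is the linear map on $K_{0,n}$ replacing the generator $e_l$ by $-e_l$, i.e. $e_A^{(l)}=-e_A$ if $l\in A$ and $e_A^{(l)}=e_A$ if $l\notin A$. For $B=\{i_1,\dots,i_k\}\subseteq\{1,\dots,n\}$, $U^{(B)}$ denotes the result of applying the conjugations $(i_1),\dots,(i_k)$ successively (they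 commute), with $U^{(\{\})}:=U$. Define $f:=\frac{1}{2^{n-1}}\sum_{A\subseteq\{1,\dots,n\}}e_A\in K_{0,n}$, $$E:=\sum_{k=0}^{\lfloor n/2\rfloor}(-1)^k\langle f\rangle_{2k},\qquad O:=\sum_{k=0}^{\lfloor n/2\rfloor}(-1)^k\langle f\rangle_{2k+1},$$ and, for $B\subseteq\{2,3,\dots,n\}$, $E_B:=E^{(B)}$ and $O_B:=O^{(B)}$. *)

(* Defs.v *)
From HB Require Import structures.
From mathcomp Require Import all_boot all_order all_algebra.
From mathcomp Require Export reals.

Set Implicit Arguments.
Unset Strict Implicit.
Unset Printing Implicit Defensive.

Import Order.TTheory GRing.Theory Num.Theory.
Local Open Scope ring_scope.

(* Indices are 0-based: i : 'I_n stands for the index i.+1 of {1, ..., n}.    *)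

Definition symd n (A B : {set 'I_n}) : {set 'I_n} := (A :\: B) :|: (B :\: A).

(* [K0 R n] is the algebra K_{0,n}, presented on its basis: an element is its *)
(* family of coordinates, and the product is the bilinear one for which       *)
(*   e_A * e_B = (-1)^|A :&: B| e_(symd A B).                                 *)
(* [basisE], [decomp] and [K0_universal] below check that this is the         *)
(* algebra with generators e_i and relations e_i^2 = -1, e_i e_j = e_j e_i,   *)
(* and that the coordinates are those on the products e_A. A record is used   *)
(* since {ffun _ -> R} already carries the pointwise product.                 *)
Record K0 (R : realType) (n : nat) : Type :=
  MkK0 { coef :> {ffun {set 'I_n} -> R} }.

HB.instance Definition _ (R : realType) n := [isNew for @coef R n].
HB.instance Definition _ (R : realType) n := [Choice of K0 R n by <:].

Section Algebra.
Variables (R : realType) (n : nat).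
Implicit Types (U V W : K0 R n) (A B C : {set 'I_n}).

Lemma K0P U V : (forall A, U A = V A) -> U = V.
Proof. by move=> UV; apply/val_inj/ffunP. Qed.

Definition K0zero : K0 R n := MkK0 [ffun=> 0].
Definition K0opp U : K0 R n := MkK0 [ffun A => - U A].
Definition K0add U V : K0 R n := MkK0 [ffun A => U A + V A].
Definition K0scale (a : R) U : K0 R n := MkK0 [ffun A => a * U A].
Definition K0one : K0 R n := MkK0 [ffun A => (A == set0)%:R].
(* For fixed A and C, e_A e_B is a multiple of e_C exactly for B = symd A C.  *)
Definition K0mul U V : K0 R n :=
  MkK0 [ffun C => \sum_A (-1) ^+ #|A :&: symd A C| * (U A * V (symd A C))].

Fact K0addA : associative K0add.
Proof. by move=> U V W; apply: K0P => A; rewrite !ffunE addrA. Qed.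
Fact K0addC : commutative K0add.
Proof. by move=> U V; apply: K0P => A; rewrite !ffunE addrC. Qed.
Fact K0add0 : left_id K0zero K0add.
Proof. by move=> U; apply: K0P => A; rewrite !ffunE add0r. Qed.
Fact K0addN : left_inverse K0zero K0opp K0add.
Proof. by move=> U; apply: K0P => A; rewrite !ffunE addNr. Qed.

HB.instance Definition _ :=
  GRing.isZmodule.Build (K0 R n) K0addA K0addC K0add0 K0addN.

Fact K0scaleA a b U : K0scale a (K0scale b U) = K0scale (a * b) U.
Proof. by apply: K0P => A; rewrite !ffunE mulrA. Qed.
Fact K0scale1 : left_id 1 K0scale.
Proof. by move=> U; apply: K0P => A; rewrite !ffunE mul1r. Qed.
Fact K0scaleDr : right_distributive K0scale +%R.
Proof. by move=> a U V; apply: K0P => A; rewrite !ffunE mulrDr. Qed.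
Fact K0scaleDl U : {morph K0scale^~ U : a b / a + b}.
Proof. by move=> a b; apply: K0P => A; rewrite !ffunE mulrDl. Qed.

HB.instance Definition _ :=
  GRing.Zmodule_isLmodule.Build R (K0 R n)
    K0scaleA K0scale1 K0scaleDr K0scaleDl.

Lemma in_symd A B i : (i \in symd A B) = (i \in A) (+) (i \in B).
Proof. by rewrite !inE; case: (i \in A); case: (i \in B). Qed.

Lemma symdK A : involutive (symd A).
Proof. by move=> B; apply/setP=> i; rewrite !in_symd; do 2!case: (_ \in _). Qed.

Lemma symdC A B : symd A B = symd B A.
Proof. by apply/setP=> i; rewrite !in_symd addbC. Qed.

Lemma signI A B : (-1) ^+ #|A :&: B| =
  \prod_i (-1) ^+ ((i \in A) && (i \in B)) :> R.
Proof.
rewrite -prodr_const big_mkcond; apply: eq_bigr => i _.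
by rewrite inE; case: (_ && _).
Qed.

Fact K0mulC : commutative K0mul.
Proof.
move=> U V; apply: K0P => C; rewrite !ffunE.
rewrite (reindex_inj (inv_inj (symdK C))) /=; apply: eq_bigr => A _.
have -> : symd (symd C A) C = A.
  by apply/setP=> i; rewrite !in_symd; do 2!case: (_ \in _).
by rewrite (symdC C) setIC [U _ * _]mulrC.
Qed.

Fact K0mulA : associative K0mul.
Proof.
move=> U V W; apply: K0P => C; rewrite !ffunE.
under eq_bigr => D _ do rewrite ffunE mulr_sumr mulr_sumr.
under [RHS]eq_bigr => A _ do rewrite ffunE mulr_suml mulr_sumr.
rewrite [RHS]exchange_big /=; apply: eq_bigr => D _.
rewrite (reindex_inj (inv_inj (symdK D))) /=; apply: eq_bigr => A _.
have -> : symd (symd D A) (symd D C) = symd A C.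
  by apply/setP=> i; rewrite !in_symd; do 3!case: (_ \in _).
set x := U D; set y := V _; set z := W _.
transitivity (((-1) ^+ #|D :&: symd D C| * (-1) ^+ #|symd D A :&: symd A C|)
    * (x * y * z)); first by rewrite -!mulrA; congr (_ * _); rewrite mulrCA.
transitivity (((-1) ^+ #|A :&: symd A C| * (-1) ^+ #|D :&: symd D A|)
    * (x * y * z)); last by rewrite -!mulrA.
congr (_ * _); rewrite !signI -!big_split /=; apply: eq_bigr => i _.
rewrite !in_symd -!signr_addb; congr ((-1) ^+ _).
by do 3!case: (_ \in _).
Qed.

Fact K0mul1 : left_id K0one K0mul.
Proof.
move=> U; apply: K0P => C; rewrite !ffunE (bigD1 set0) //= big1 => [|A /negPf A0].
  rewrite ffunE eqxx set0I cards0 mul1r mul1r addr0.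
  by congr (U _); apply/setP=> i; rewrite in_symd inE.
by rewrite ffunE A0 mul0r mulr0.
Qed.

Fact K0mulDl : left_distributive K0mul +%R.
Proof.
move=> U V W; apply: K0P => C; rewrite !ffunE -big_split /=.
by apply: eq_bigr => A _; rewrite ffunE mulrDl mulrDr.
Qed.

Fact K0one_neq0 : K0one != 0.
Proof.
apply/eqP => /(congr1 (fun U : K0 R n => U set0)).
by rewrite !ffunE eqxx; apply/eqP; rewrite oner_neq0.
Qed.

HB.instance Definition _ := GRing.Zmodule_isComNzRing.Build (K0 R n)
  K0mulA K0mulC K0mul1 K0mulDl K0one_neq0.

Fact K0scaleAl (a : R) U V : a *: (U * V) = (a *: U) * V.
Proof.
apply: K0P => C; rewrite !ffunE mulr_sumr; apply: eq_bigr => A _.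
by rewrite ffunE -mulrA mulrCA.
Qed.

HB.instance Definition _ := GRing.Lmodule_isLalgebra.Build R (K0 R n) K0scaleAl.
HB.instance Definition _ := GRing.Lalgebra_isComAlgebra.Build R (K0 R n).

Definition e (i : 'I_n) : K0 R n := MkK0 [ffun A => (A == [set i])%:R].

Definition eA (A : {set 'I_n}) : K0 R n := \prod_(i in A) e i.

Definition proj (k : nat) (U : K0 R n) : K0 R n :=
  MkK0 [ffun A : {set 'I_n} => if #|A| == k then U A else 0].

Definition gconj (l : 'I_n) (U : K0 R n) : K0 R n :=
  MkK0 [ffun A : {set 'I_n} => if l \in A then - U A else U A].

Definition conjs (B : {set 'I_n}) (U : K0 R n) : K0 R n :=
  foldr gconj U (enum B).

(* The index set {2, ..., n}. *)
Definition idx2 : {set 'I_n} := [set i : 'I_n | (0 < i)%N].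

Definition felt : K0 R n := (2 ^+ n.-1)^-1 *: \sum_(A : {set 'I_n}) eA A.

Definition Eelt : K0 R n :=
  \sum_(0 <= k < n./2.+1) (-1) ^+ k *: proj k.*2 felt.

Definition Oelt : K0 R n :=
  \sum_(0 <= k < n./2.+1) (-1) ^+ k *: proj k.*2.+1 felt.

Definition EB (B : {set 'I_n}) : K0 R n := conjs B Eelt.
Definition OB (B : {set 'I_n}) : K0 R n := conjs B Oelt.

Definition delta A : K0 R n := MkK0 [ffun B => (B == A)%:R].

Lemma deltaM A B :
  delta A * delta B = (-1) ^+ #|A :&: B| *: delta (symd A B).
Proof.
apply: K0P => C; rewrite !ffunE (bigD1 A) //= big1 => [|D /negPf DA].
  rewrite !ffunE eqxx mul1r addr0.
  have -> : (symd A C == B) = (C == symd A B).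
    by apply/eqP/eqP=> [<-|->]; rewrite symdK.
  by case: eqP => [->|]; rewrite ?mulr0 // symdK.
by rewrite !ffunE DA mul0r mulr0.
Qed.

Lemma basisE A : eA A = delta A.
Proof.
rewrite /eA; move: {2}#|A| (erefl #|A|) => m; elim: m A => [|m IHm] A.
  by move/eqP; rewrite cards_eq0 => /eqP ->; rewrite big_set0.
move=> cA; have [i iA] : exists i, i \in A by apply/card_gt0P; rewrite cA.
rewrite (big_setD1 i iA) /= IHm; last first.
  by move: cA; rewrite (cardsD1 i) iA => -[].
rewrite [e i]/(delta [set i]) deltaM.
have -> : [set i] :&: (A :\ i) = set0.
  by apply/setP => j; rewrite !inE; case: eqP.
rewrite cards0 scale1r; congr delta; apply/setP=> j.
by rewrite in_symd !inE; case: eqP => // ->; rewrite iA.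
Qed.

Lemma coef_sum (I : Type) (r : seq I) (P : pred I) (F : I -> K0 R n) A :
  (\sum_(i <- r | P i) F i) A = \sum_(i <- r | P i) F i A.
Proof. by elim/big_rec2: _ => [|i x y _ <-]; rewrite ffunE. Qed.

Lemma decomp U : U = \sum_A U A *: eA A.
Proof.
apply: K0P => B; rewrite coef_sum (bigD1 B) //= big1 => [|A /negPf AB].
  by rewrite basisE !ffunE eqxx mulr1 addr0.
by rewrite basisE !ffunE eq_sym AB mulr0.
Qed.

Lemma e_sqr i : e i ^+ 2 = -1.
Proof.
rewrite expr2 [e i]/(delta [set i]) deltaM setIid cards1 expr1 scaleN1r.
rewrite (_ : symd _ _ = set0) //.
by apply/setP=> j; rewrite in_symd addbb in_set0.
Qed.

Lemma gconj_eA l A : gconj l (eA A) = if l \in A then - eA A else eA A.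
Proof.
rewrite basisE; apply: K0P => B; rewrite ffunE.
case: ifP => lB; case: ifP => lA; rewrite !ffunE //.
  by case: eqP lA => [<-|]; rewrite ?lB ?oppr0.
by case: eqP lA => [<-|]; rewrite ?lB ?oppr0.
Qed.

(* An algebra generated by commuting elements is commutative, so comparing    *)
(* with commutative targets is enough.                                        *)
Lemma K0_universal (S : comAlgType R) (g : 'I_n -> S) :
  (forall i, g i ^+ 2 = -1) ->
  exists phi : {lrmorphism K0 R n -> S}, (forall i, phi (e i) = g i) /\
    forall psi : {lrmorphism K0 R n -> S},
      (forall i, psi (e i) = g i) -> psi =1 phi.
Proof.
move=> gi2; pose gA A := \prod_(i in A) g i.
pose phi U : S := \sum_A U A *: gA A.
have gM A B : gA A * gA B = (-1) ^+ #|A :&: B| *: gA (symd A B).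
  rewrite /gA 3!(big_mkcond (fun i => i \in _)) -big_split /=.
  rewrite signI -scaler_prod; apply: eq_bigr => i _; rewrite in_symd.
  case: (i \in A); case: (i \in B); rewrite /= ?scale1r ?mulr1 ?mul1r //.
  by rewrite scaleN1r -expr2 gi2.
have phi_lin : linear phi.
  move=> a U V; rewrite /phi scaler_sumr -big_split /=; apply: eq_bigr => A _.
  by rewrite !ffunE scalerDl scalerA.
pose L := GRing.isLinear.Build R (K0 R n) S *:%R phi phi_lin.
pose phiL : {linear K0 R n -> S} := HB.pack phi L.
have phiZ a U : phi (a *: U) = a *: phi U by exact: (linearZZ phiL).
have phi_sum (F : {set 'I_n} -> K0 R n) : phi (\sum_A F A) = \sum_A phi (F A).
  exact: (linear_sum phiL).
have phi_d A : phi (delta A) = gA A.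
  rewrite /phi (bigD1 A) //= big1 => [|B /negPf BA].
    by rewrite ffunE eqxx scale1r addr0.
  by rewrite ffunE BA scale0r.
have phi_mon : monoid_morphism phi.
  split; first by rewrite [1]/(delta set0) phi_d /gA big_set0.
  move=> U V; rewrite (decomp U) (decomp V) mulr_suml.
  rewrite !phi_sum mulr_suml; apply: eq_bigr => A _.
  rewrite mulr_sumr phi_sum mulr_sumr; apply: eq_bigr => B _.
  rewrite -scalerAl -scalerAr !phiZ -scalerAl -scalerAr !basisE deltaM phiZ.
  by rewrite !phi_d gM.
pose M := GRing.isMonoidMorphism.Build (K0 R n) S phi phi_mon.
pose phiR : {lrmorphism K0 R n -> S} := HB.pack phi L M.
exists phiR; split=> [i|psi psig U].
  by rewrite -[phiR _]/(phi (delta [set i])) phi_d /gA big_set1.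
rewrite [in LHS](decomp U) linear_sum; apply: eq_bigr => A _.
rewrite linearZ /=; congr (_ *: _).
by rewrite /eA rmorph_prod; apply: eq_bigr => i _; exact: psig.
Qed.

End Algebra.

Arguments e {R n} i.
Arguments EB {R n} B.
Arguments OB {R n} B.

(* Main.v *)
Require Import Defs.
From mathcomp Require Import all_boot all_order all_algebra.

Import GRing.Theory Num.Theory.
Local Open Scope ring_scope.

(** Every generator acts on [Eelt] in the same way: [e k * Eelt = Oelt] for all
    [k].  This reflects the fact that, after complexification, [Eelt + i Oelt]
    is [2 ^- (n - 1)] times the product of the commuting factors [1 + i e_j],
    each of which satisfies [e_j (1 + i e_j) = - i (1 + i e_j)].  Here it is read
    off the coordinates of [Eelt] and [Oelt], which are up to a factor the real
    and imaginary parts of powers of [i] ([mul_e_Eelt]).  Since [e k ^+ 2 = -1], it also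
    gives [e k * Oelt = - Eelt].  The conjugation by [B] is a ring morphism that
    changes the sign of the generators indexed by [B] ([conjsM], [conjs_e]), so
    part (2) follows.

    The sum of the conjugates of an element by all subsets of [idx2] kills, by
    orthogonality of signs, each coordinate at a set that meets [idx2]
    ([sum_sign]).  A set that does not meet [idx2] has at most the element 0, so
    it is empty if its size is even.  Hence the sum of the [EB B] is a scalar,
    namely 1 ([sum_EB]).

    By part (2), whose formulas also hold for the generator [e ord0], [EB B] is
    an eigenvector of [e ord0 * e k] for [k] in [idx2], with eigenvalue 1 if
    [k \in B] and -1 otherwise.  The product of eigenvectors for 1 and -1 equals
    its own opposite, hence [Eelt * EB B = 0] for nonempty [B] ([Eelt_EB_eq0]).  Multiplying the
    partition of unity by [Eelt] leaves [Eelt = Eelt ^+ 2], and the other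
    identities of part (1) follow from [Oelt = e ord0 * Eelt]. *)

(** * Conjugations and products in coordinates *)

Section Conjugation.
Variables (R : realType) (n : nat).
Implicit Types (U V : K0 R n) (A B C : {set 'I_n}) (k : 'I_n).

Lemma conjs_coef B U A : conjs B U A = (-1) ^+ #|A :&: B| * U A.
Proof.
have -> : #|A :&: B| = count [in A] (enum B).
  rewrite -sum1_count big_enum_cond -sum1_card.
  by apply: eq_bigl => i; rewrite inE andbC.
rewrite /conjs; elim: (enum B) => [|l s IHs] /=; first by rewrite mul1r.
by rewrite ffunE IHs; case: (l \in A) => /=; rewrite ?exprS ?mulN1r ?mulNr.
Qed.

Lemma conjs0 U : conjs set0 U = U.
Proof. by apply: K0P => A; rewrite conjs_coef setI0 cards0 mul1r. Qed.

Lemma conjsN B U : conjs B (- U) = - conjs B U.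
Proof. by apply: K0P => A; rewrite conjs_coef !ffunE conjs_coef mulrN. Qed.

(** The coordinate of a product at [C] is a sum over pairs [A], [symd A C], and
    the sign attached to [C] is the product of the signs of the two members. *)
Lemma conjsM B U V : conjs B (U * V) = conjs B U * conjs B V.
Proof.
apply: K0P => C; rewrite conjs_coef !ffunE mulr_sumr; apply: eq_bigr => A _.
rewrite !conjs_coef.
have -> : (-1) ^+ #|C :&: B|
    = (-1) ^+ #|A :&: B| * (-1) ^+ #|symd A C :&: B| :> R.
  rewrite !signI -big_split /=; apply: eq_bigr => i _.
  by rewrite in_symd -signr_addb; do 3!case: (_ \in _).
by rewrite mulrCA -!mulrA; do 2!congr (_ * _); rewrite mulrCA.
Qed.

Lemma conjs_e B k : conjs B (e k) = (if k \in B then - e k else e k) :> K0 R n.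
Proof.
apply: K0P => A; rewrite conjs_coef ffunE.
have [->|neqA] := eqVneq A [set k]; last first.
  by rewrite mulr0; case: ifP => _; rewrite !ffunE (negPf neqA) ?oppr0.
case: ifP => kB; rewrite !ffunE eqxx mulr1.
  by rewrite (setIidPl _) ?sub1set // cards1.
have /eqP -> : [set k] :&: B == set0 by rewrite setI_eq0 disjoints1 kB.
by rewrite cards0.
Qed.

Lemma mul_e_coef k U C :
  (e k * U) C = (if k \in C then 1 else -1) * U (symd [set k] C).
Proof.
rewrite ffunE (bigD1 [set k]) //= big1 => [|A /negPf neqA]; last first.
  by rewrite ffunE neqA mul0r mulr0.
rewrite addr0 ffunE eqxx mul1r; congr (_ * _).
case: ifP => kC.
  have /eqP -> : [set k] :&: symd [set k] C == set0.
    by rewrite setI_eq0 disjoints1 in_symd inE eqxx kC.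
  by rewrite cards0.
by rewrite (setIidPl _) ?cards1 // sub1set in_symd inE eqxx kC.
Qed.

End Conjugation.

(** * Action of the generators *)

Section Action.
Variables (R : realType) (n : nat).
Implicit Types (A B C : {set 'I_n}) (k : 'I_n).
Notation E := (Eelt R n).
Notation O := (Oelt R n).

Lemma felt_coef A : felt R n A = (2 ^+ n.-1)^-1.
Proof.
rewrite ffunE Defs.coef_sum (bigD1 A) //= big1 => [|B /negPf neqB].
  by rewrite basisE ffunE eqxx addr0 mulr1.
by rewrite basisE ffunE eq_sym neqB.
Qed.

Lemma half_card_lt A : (#|A|./2 < n./2.+1)%N.
Proof. by rewrite ltnS half_leq // -[leqRHS]card_ord max_card. Qed.

Lemma proj_felt_coef (a : R) m A :
  (a *: proj m (felt R n)) A = if #|A| == m then a * (2 ^+ n.-1)^-1 else 0.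
Proof.
rewrite [LHS]ffunE [in LHS]ffunE felt_coef.
by case: ifP => // _; rewrite mulr0.
Qed.

Lemma Eelt_coef A :
  E A = if odd #|A| then 0 else (-1) ^+ #|A|./2 * (2 ^+ n.-1)^-1.
Proof.
rewrite Defs.coef_sum big_mkord; under eq_bigr do rewrite proj_felt_coef.
rewrite -big_mkcond /=; case: ifPn => [oddA|evenA].
  by apply: big_pred0 => k; apply: contraTF oddA => /eqP->; rewrite odd_double.
rewrite (big_pred1 (Ordinal (half_card_lt A))) // => k.
apply/eqP/eqP => [cA|->]; first by apply/val_inj; rewrite /= cA doubleK.
by rewrite even_halfK.
Qed.

Lemma Oelt_coef A :
  O A = if odd #|A| then (-1) ^+ #|A|./2 * (2 ^+ n.-1)^-1 else 0.
Proof.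
rewrite Defs.coef_sum big_mkord; under eq_bigr do rewrite proj_felt_coef.
rewrite -big_mkcond /=; case: ifPn => [oddA|evenA]; last first.
  apply: big_pred0 => k; apply: contraNF evenA => /eqP->.
  by rewrite /= odd_double.
rewrite (big_pred1 (Ordinal (half_card_lt A))) // => k.
apply/eqP/eqP => [cA|->]; first by apply/val_inj; rewrite /= cA /= uphalf_double.
by rewrite odd_halfK // prednK // odd_gt0.
Qed.

(** Up to a common factor, the coordinates of [E] and [O] at a set of size [m]
    are the real and imaginary parts of [i ^ m].  Multiplication by [e k] toggles
    [k] in the index set, with sign [e k ^+ 2 = -1] when [k] is removed.  So the
    coordinate of [e k * E] at [C] is the real part of [i ^ (|C| - 1)] or of
    [- i ^ (|C| + 1)], and both are the imaginary part of [i ^ |C|]. *)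
Lemma mul_e_Eelt k : e k * E = O.
Proof.
apply: K0P => C; rewrite mul_e_coef Eelt_coef Oelt_coef.
case: ifP => kC.
  have -> : symd [set k] C = C :\ k.
    by apply/setP=> i; rewrite in_symd !inE; case: eqP => // ->; rewrite kC.
  rewrite (cardsD1 k C) kC add1n /= uphalf_half mul1r.
  by case: (odd _).
have -> : symd [set k] C = k |: C.
  by apply/setP=> i; rewrite in_symd !inE; case: eqP => // ->; rewrite kC.
rewrite cardsU1 kC add1n /= uphalf_half.
case: (odd _); last by rewrite mulr0.
by rewrite add1n exprS !mulN1r mulNr opprK.
Qed.

Lemma mul_e_Oelt k : e k * O = - E.
Proof. by rewrite -(mul_e_Eelt k) mulrA -expr2 e_sqr mulN1r. Qed.

Lemma mul_e_EB B k : e k * EB B = (if k \in B then - OB B else OB B) :> K0 R n.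
Proof.
rewrite /EB /OB; have := congr1 (conjs B) (mul_e_Eelt k); rewrite conjsM conjs_e.
by case: ifP => // _ <-; rewrite mulNr opprK.
Qed.

Lemma mul_e_OB B k : e k * OB B = (if k \in B then EB B else - EB B) :> K0 R n.
Proof.
rewrite /EB /OB; have := congr1 (conjs B) (mul_e_Oelt k).
rewrite conjsM conjs_e conjsN.
by case: ifP => // _; rewrite mulNr => /oppr_inj.
Qed.

End Action.

(** * Partition of unity and idempotence *)

(** Orthogonality of characters of the group of subsets of [J]: the sum is the
    expansion of the product over [i] in [J] of [1 + (-1) ^+ (i \in A)]. *)
Lemma sum_sign (R : comPzRingType) (T : finType) (A J : {set T}) :
  \sum_(B : {set T} | B \subset J) (-1) ^+ #|A :&: B|
    = (if [disjoint A & J] then 2 ^+ #|J| else 0) :> R.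
Proof.
pose F i : R := if i \in J then (-1) ^+ (i \in A) else 0.
transitivity (\prod_i (F i + 1)).
  rewrite bigA_distr big_mkcond /=; apply: eq_bigr => B _.
  case: ifPn => [sBJ | /subsetPn[i iB iJ]]; last first.
    by rewrite (bigD1 i) //= iB /F (negPf iJ) mul0r.
  rewrite -prodr_const big_mkcond /=; apply: eq_bigr => i _.
  rewrite inE /F; have [iB|_] := boolP (i \in B); last by rewrite andbF.
  by rewrite (subsetP sBJ) // andbT; case: (i \in A).
have [dAJ | /pred0Pn[i /andP[/= iA iJ]]] := boolP [disjoint A & J].
  rewrite -prodr_const [RHS]big_mkcond; apply: eq_bigr => i _; rewrite /F.
  by case: ifP => [iJ|]; rewrite ?add0r // (disjointFl dAJ iJ).
by rewrite (bigD1 i) //= /F iJ iA expr1 addNr mul0r.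
Qed.

(** Holds since [2] is invertible in [R]; makes eigenvectors for the eigenvalues
    1 and -1 of one multiplication orthogonal. *)
Lemma K0_eqN_eq0 (R : realType) n (U : K0 R n) : U = - U -> U = 0.
Proof.
move/eqP; rewrite -addr_eq0 -mulr2n -scaler_nat scaler_eq0 pnatr_eq0 /=.
by move/eqP.
Qed.

Section Partition.
Variables (R : realType) (n : nat).
Implicit Types B : {set 'I_n.+1}.
Notation E := (Eelt R n.+1).
Notation O := (Oelt R n.+1).

Lemma card_idx2 : #|idx2 n.+1| = n.
Proof.
have -> : idx2 n.+1 = [set~ ord0] by apply/setP=> i; rewrite !inE -val_eqE -lt0n.
by rewrite cardsC1 card_ord.
Qed.

Lemma sum_EB :
  \sum_(B : {set 'I_n.+1} | B \subset idx2 n.+1) EB B = 1 :> K0 R n.+1.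
Proof.
apply: K0P => A; rewrite Defs.coef_sum.
under eq_bigr do rewrite conjs_coef.
rewrite -mulr_suml sum_sign card_idx2 Eelt_coef ffunE.
have [->|A0] := eqVneq A set0.
  rewrite disjoints_subset sub0set cards0 /= mul1r mulfV //.
  by rewrite expf_neq0 ?pnatr_eq0.
case: ifPn => [dA|_]; last by rewrite mul0r.
have -> : A = [set ord0].
  have sA : A \subset [set ord0].
    apply/subsetP=> i iA; move/disjointFr/(_ iA): dA.
    by rewrite !inE -val_eqE /= lt0n => /negbFE.
  by move: sA; rewrite subset1 (negPf A0) orbF => /eqP.
by rewrite cards1 mulr0.
Qed.

Lemma Eelt_EB_eq0 B : B \subset idx2 n.+1 -> B != set0 -> E * EB B = 0.
Proof.
move=> sBJ /set0Pn[k kB].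
have k0 : ord0 \notin B by apply: contraTN isT => /(subsetP sBJ); rewrite inE.
have actE : e ord0 * e k * E = - E by rewrite -mulrA mul_e_Eelt mul_e_Oelt.
have actEB : e ord0 * e k * EB B = EB B :> K0 R n.+1.
  by rewrite -mulrA mul_e_EB kB mulrN mul_e_OB (negPf k0) opprK.
by apply: K0_eqN_eq0; rewrite -[in LHS]actEB mulrCA mulrA actE mulNr.
Qed.

Lemma Eelt_idem : E ^+ 2 = E.
Proof.
have := congr1 ( *%R E) sum_EB; rewrite mulr1 (bigD1 set0) ?sub0set //= mulrDr.
rewrite mulr_sumr big1 => [|B /andP[]]; last exact: Eelt_EB_eq0.
by rewrite /EB conjs0 addr0.
Qed.

Lemma EB_idem B : EB B ^+ 2 = EB B :> K0 R n.+1.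
Proof. by rewrite expr2 -conjsM -expr2 Eelt_idem. Qed.

Lemma EB_OB B : EB B * OB B = OB B :> K0 R n.+1.
Proof.
by rewrite /OB -conjsM -(mul_e_Eelt R n.+1 ord0) mulrCA -expr2 Eelt_idem.
Qed.

Lemma OB_sqr B : OB B ^+ 2 = - EB B :> K0 R n.+1.
Proof.
rewrite expr2 -conjsM -conjsN -(mul_e_Eelt R n.+1 ord0) mulrACA -!expr2 e_sqr.
by rewrite Eelt_idem mulN1r.
Qed.

End Partition.

Theorem lemma6p7 (R : realType) (n : nat) (hn : (1 <= n)%N) :
  (forall B : {set 'I_n}, B \subset idx2 n ->
     [/\ OB B ^+ 2 = - EB B :> K0 R n,
         EB B ^+ 2 = EB B :> K0 R n
       & EB B * OB B = OB B :> K0 R n] /\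
     (forall k : 'I_n, k \in idx2 n ->
        e k * OB B = (if k \in B then EB B else - EB B) :> K0 R n /\
        e k * EB B = (if k \in B then - OB B else OB B) :> K0 R n)) /\
  \sum_(B : {set 'I_n} | B \subset idx2 n) EB B = 1 :> K0 R n.
Proof.
case: n hn => [//|n] _; split; last exact: sum_EB.
move=> B _; split; first by split; [exact: OB_sqr|exact: EB_idem|exact: EB_OB].
by move=> k _; split; [exact: mul_e_OB|exact: mul_e_EB].
Qed.
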